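(* Let $\epsilon,\lambda,h,\Delta t>0$ and $0<\epsilon_1<\frac12$, and let $\gamma=\frac{2}{\epsilon}+\frac{2\omega\lambda\pi}{\epsilon_1^2}$, where $\omega$ is the number of channels of the image $I$. Assume the image values $I_\ell(r)$ and the (fixed) average intensities $\mathbf C_{ab}(r)$ all lie in $[0,1]$. Suppose the stabilizer satisfies $S\ge\gamma$. Let $\mathbf U^k=(U_1^k,U_2^k)$, $k\ge0$, be generated from $\mathbf U^0=\mathbf u^0$ by the ETD1 scheme, or by the ETDRK2 scheme, both given in the context. If the initial value satisfies $0\le\mathbf u^0\le1$ (entrywise), then all entries of $\mathbf U^k$ lie in $[0,1]$ for all $k>0$.
   Context: The image $I$ has $M_1\times M_2$ pixels and $\omega$ channels; $I_\ell(r)$ is its value at pixel $\ell\in\{1,\dots,M_1M_2\}$ in channel $r$. $\mathbf C=(\mathbf C_{11},\mathbf C_{12},\mathbf C_{21},\mathbf C_{22})$ with $\mathbf C_{ab}(r)$ a real constant (independent of the pixel) for each channel $r$. The phase variables are $U_1,U_2\in\mathbb R^{M_1M_2}$. Regularized Heaviside function: $H_{\epsilon_1}(u)=\frac{1}{2\epsilon_1}\left(u+\frac{\epsilon_1}{\pi}\sin\frac{\pi u}{\epsilon_1}\right)+\frac12$ for $|u|\le\epsilon_1$, $H_{\epsilon_1}(u)=1$ for $u>\epsilon_1$, $H_{\epsilon_1}(u)=0$ for $u<-\epsilon_1$; its derivative is $\delta_{\epsilon_1}(u)=\frac{1}{2\epsilon_1}\left(1+\cos\frac{\pi u}{\epsilon_1}\right)$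 for $|u|\le\epsilon_1$ and $0$ for $|u|>\epsilon_1$. Let $w(u)=2u(2u-1)(u-1)$ (the derivative of $W(u)=u^2(u-1)^2$). Pixelwise, with $A_{ab}(r)=(I(r)-\mathbf C_{ab}(r))^2$, the fitting terms are $$f_1(u_1,u_2,\mathbf C)=\lambda\sum_{r=1}^{\omega}\Big\{[A_{11}(r)-A_{21}(r)]H_{\epsilon_1}(u_2-\tfrac12)+[A_{12}(r)-A_{22}(r)]\big(1-H_{\epsilon_1}(u_2-\tfrac12)\big)\Big\}\delta_{\epsilon_1}(u_1-\tfrac12),$$ $$f_2(u_1,u_2,\mathbf C)=\lambda\sum_{r=1}^{\omega}\Big\{[A_{11}(r)-A_{12}(r)]H_{\epsilon_1}(u_1-\tfrac12)+[A_{21}(r)-A_{22}(r)]\big(1-H_{\epsilon_1}(u_1-\tfrac12)\big)\Big\}\delta_{\epsilon_1}(u_2-\tfrac12).$$ Let $D_h=\frac1{h^2}(I_{M_2}\otimes\Lambda_{M_1}+\Lambda_{M_2}\otimes I_{M_1})$, where $I_M$ is the $M\times M$ identity and $\Lambda_M$ is the $M\times M$ tridiagonal matrix with off-diagonal entries $1$ and diagonal entries $-1,-2,\dots,-2,-1$ (discrete Neumann Laplacian). With stabilizer $S>0$ set $$L_h=-2\epsilon D_h+S\,I_{M_1M_2},\qquad N_i(\mathbf U)=SU_i-\frac1\epsilon w(U_i)-f_i(U_1,U_2,\mathbf C)\ \text{(entrywise)},\quad i=1,2.$$ The space-discrete system is $\frac{dU_i}{dt}+L_hU_i=N_i(\mathbf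 U)$, $i=1,2$. Put $\phi_0(a)=e^{-a}$, $\phi_1(a)=\frac{1-e^{-a}}{a}$, $\phi_2(a)=\frac{e^{-a}-1+a}{a^2}$, applied to matrices by functional calculus. ETD1 scheme: for $i=1,2$, $U_i^{k+1}=\phi_0(L_h\Delta t)U_i^k+\Delta t\,\phi_1(L_h\Delta t)N_i(\mathbf U^k)$. ETDRK2 scheme: for $i=1,2$, $\hat U_i^{k+1}=\phi_0(L_h\Delta t)U_i^k+\Delta t\,\phi_1(L_h\Delta t)N_i(\mathbf U^k)$, then $U_i^{k+1}=\hat U_i^{k+1}+\Delta t\,\phi_2(L_h\Delta t)\big(N_i(\hat{\mathbf U}^{k+1})-N_i(\mathbf U^k)\big)$. *)

(* Defs.v *)
From HB Require Import structures.
From mathcomp Require Import all_boot all_order all_algebra.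
From mathcomp Require Import all_classical all_reals all_analysis.
From mathcomp.real_closed Require Import complex mxtens.

Set Implicit Arguments.
Unset Strict Implicit.
Unset Printing Implicit Defensive.

Import Order.TTheory GRing.Theory Num.Theory.

Local Open Scope ring_scope.

Definition heaviside_reg (R : realType) (eps1 u : R) : R :=
  if `|u| <= eps1 then
    1 / (2 * eps1) * (u + eps1 / pi * sin (pi * u / eps1)) + 1 / 2
  else if eps1 < u then 1 else 0.

Definition delta_reg (R : realType) (eps1 u : R) : R :=
  if `|u| <= eps1 then 1 / (2 * eps1) * (1 + cos (pi * u / eps1)) else 0.

Definition dwell (R : realType) (u : R) : R := 2 * u * (2 * u - 1) * (u - 1).

Record intensities (R : realType) (omega : nat) := Intensities {
  C11 : 'I_omega -> R;
  C12 : 'I_omega -> R;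
  C21 : 'I_omega -> R;
  C22 : 'I_omega -> R }.

(* [v] is the value of the image at one pixel, [v r] its channel [r]. *)
Definition fit1 (R : realType) (omega : nat) (lambda eps1 : R)
    (v : 'I_omega -> R) (C : intensities R omega) (u1 u2 : R) : R :=
  lambda * (\sum_(r < omega)
    (((v r - C11 C r) ^+ 2 - (v r - C21 C r) ^+ 2)
        * heaviside_reg eps1 (u2 - 1 / 2)
     + ((v r - C12 C r) ^+ 2 - (v r - C22 C r) ^+ 2)
        * (1 - heaviside_reg eps1 (u2 - 1 / 2))))
  * delta_reg eps1 (u1 - 1 / 2).

Definition fit2 (R : realType) (omega : nat) (lambda eps1 : R)
    (v : 'I_omega -> R) (C : intensities R omega) (u1 u2 : R) : R :=
  lambda * (\sum_(r < omega)
    (((v r - C11 C r) ^+ 2 - (v r - C12 C r) ^+ 2)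
        * heaviside_reg eps1 (u1 - 1 / 2)
     + ((v r - C21 C r) ^+ 2 - (v r - C22 C r) ^+ 2)
        * (1 - heaviside_reg eps1 (u1 - 1 / 2))))
  * delta_reg eps1 (u2 - 1 / 2).

(* The diagonal entry is minus the number of neighbours of [i] in [0, M - 1]:
   -1, -2, ..., -2, -1 when M >= 2, and 0 in the degenerate case M = 1. *)
Definition neumann_lap (R : realType) (M : nat) : 'M[R]_M :=
  \matrix_(i, j)
    if i == j then - ((0 < i) + (i.+1 < M))%:R
    else ((i.+1 == j :> nat) || (j.+1 == i :> nat))%:R.

Definition Dh (R : realType) (M1 M2 : nat) (h : R) : 'M[R]_(M2 * M1) :=
  (h ^+ 2)^-1 *: (tensmx (1%:M : 'M[R]_M2) (neumann_lap R M1)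
                  + tensmx (neumann_lap R M2) (1%:M : 'M[R]_M1)).

Definition Lh (R : realType) (M1 M2 : nat) (h eps S : R) : 'M[R]_(M2 * M1) :=
  - (2 * eps) *: Dh M1 M2 h + S%:M.

Definition nonlin (R : realType) (n omega : nat) (eps lambda eps1 S : R)
    (img : 'I_n -> 'I_omega -> R) (C : intensities R omega)
    (U : 'cV[R]_n * 'cV[R]_n) : 'cV[R]_n * 'cV[R]_n :=
  (\col_l (S * U.1 l 0 - 1 / eps * dwell (U.1 l 0)
           - fit1 lambda eps1 (img l) C (U.1 l 0) (U.2 l 0)),
   \col_l (S * U.2 l 0 - 1 / eps * dwell (U.2 l 0)
           - fit2 lambda eps1 (img l) C (U.1 l 0) (U.2 l 0))).

(* [phi1] and [phi2] take a junk value at 0, where the singularity is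
   removable; they are only applied to matrices with positive spectrum. *)
Definition phi0 (R : realType) (a : R) : R := expR (- a).
Definition phi1 (R : realType) (a : R) : R := (1 - expR (- a)) / a.
Definition phi2 (R : realType) (a : R) : R := (expR (- a) - 1 + a) / a ^+ 2.

(* Functional calculus for real diagonalizable matrices. By [fun_mxP] the
   default value in [fun_mx] is never used on symmetric matrices. *)
Definition is_fun_mx (R : realType) (f : R -> R) (n : nat) (A B : 'M[R]_n) :=
  exists (P : 'M[R]_n) (d : 'rV[R]_n),
    [/\ P \in unitmx, A = invmx P *m diag_mx d *m P
      & B = invmx P *m diag_mx (map_mx f d) *m P].

Definition fun_mx (R : realType) (f : R -> R) (n : nat) (A : 'M[R]_n) : 'M[R]_n :=
  xget 0 [set B | is_fun_mx f A B].

Lemma is_fun_mx_unique (R : realType) (f : R -> R) (n : nat) (A B B' : 'M[R]_n) :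
  is_fun_mx f A B -> is_fun_mx f A B' -> B = B'.
Proof.
move=> [P [d [Pu -> ->]]] [Q [e [Qu E ->]]].
pose T := Q *m invmx P.
have ET : T *m diag_mx d = diag_mx e *m T.
  have := congr1 (fun X => Q *m X *m invmx P) E.
  by rewrite /T !mulmxA mulmxV // mul1mx mulmxK.
have FT : T *m diag_mx (map_mx f d) = diag_mx (map_mx f e) *m T.
  apply/matrixP => i j; have /matrixP/(_ i j) := ET.
  rewrite !mul_mx_diag !mul_diag_mx !mxE; set t := \sum_k _.
  have [->|t0] := eqVneq t 0; first by rewrite !mul0r !mulr0.
  by rewrite [RHS]mulrC => /(mulfI t0) ->; rewrite mulrC.
have := congr1 (fun X => invmx Q *m X *m P) FT.
by rewrite /T !mulmxA mulVmx // mul1mx mulmxKV.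
Qed.

Lemma sym_is_fun_mx (R : realType) (f : R -> R) (n : nat) (A : 'M[R]_n) :
  A^T = A -> exists B, is_fun_mx f A B.
Proof.
case: n A => [|n] A symA.
  by exists A, 1%:M, 0; split; rewrite ?unitmx1 //; apply/matrixP => -[].
suff: diagonalizable A.
  move=> [P Pu /(diagonalizable_forLR Pu)[d Ad]].
  exists (invmx P *m diag_mx (map_mx f d) *m P), P, d; split=> //.
  by rewrite Ad mxpoly.conjVmx.
pose Ac := map_mx (real_complex R) A.
have hAc : Ac \is hermsymmx.
  apply/is_hermitianmxP; rewrite expr0 scale1r.
  apply/matrixP=> i j; rewrite !mxE -{1}symA mxE; apply/esym/CrealP.
  by rewrite complex_real.
have /hermitian_normalmx/orthomx_spectralP EAc := hAc.
have /mxOverP dR := hermitian_spectral_diag_real hAc.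
pose d : 'rV[R]_n.+1 := map_mx (@complex.Re R) (spectral_diag Ac).
pose rs := undup [seq d 0 i | i <- enum 'I_n.+1].
apply/mxpoly.diagonalizableP; exists rs; first exact: undup_uniq.
rewrite -(dvdp_map (real_complex R)) -mxpoly.mxminpoly_map -/Ac.
rewrite EAc -mxpoly.conjVmx ?spectral_unit //.
rewrite mxpoly.mxminpoly_uconj ?unitmx_inv ?spectral_unit // mxminpoly_diag.
rewrite rmorph_prod /=.
under [X in _ %| X]eq_bigr do rewrite rmorphB /= map_polyX map_polyC /=.
rewrite -(big_map (real_complex R) xpredT (fun x => 'X - x%:P)).
rewrite /rs -undup_map_inj; last exact: complexI.
set s1 := undup _; set s2 := undup _; suff -> : s1 = s2 by [].
congr undup; rewrite -[RHS]map_comp; apply: eq_map => i /=.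
by rewrite mxE; apply/esym/RRe_real; exact: dR.
Qed.

Lemma fun_mxP (R : realType) (f : R -> R) (n : nat) (A B : 'M[R]_n) :
  A^T = A -> (fun_mx f A = B <-> is_fun_mx f A B).
Proof.
move=> symA; have [B0 AB0] := sym_is_fun_mx f symA.
have fA : is_fun_mx f A (fun_mx f A).
  by rewrite /fun_mx; case: xgetP => // /(_ B0).
by split=> [<-//|]; exact: is_fun_mx_unique.
Qed.

Lemma Lh_sym (R : realType) (M1 M2 : nat) (h eps S : R) :
  (Lh M1 M2 h eps S)^T = Lh M1 M2 h eps S.
Proof.
have lap M : (neumann_lap R M)^T = neumann_lap R M.
  apply/matrixP => i j; rewrite !mxE eq_sym orbC.
  by case: eqP => // ->.
rewrite /Lh [LHS]linearD /= tr_scalar_mx [X in X + _]linearZ /=; congr (_ *: _ + _).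
rewrite /Dh [LHS]linearZ /=; congr (_ *: _).
by rewrite [LHS]linearD /= !trmx_tens !tr_scalar_mx !lap.
Qed.

Definition etd1_comp (R : realType) (n : nat) (L : 'M[R]_n) (dt : R)
    (u Nu : 'cV[R]_n) : 'cV[R]_n :=
  fun_mx (@phi0 R) (dt *: L) *m u + dt *: (fun_mx (@phi1 R) (dt *: L) *m Nu).

Definition etd1_step (R : realType) (n : nat) (L : 'M[R]_n) (dt : R)
    (N : 'cV[R]_n * 'cV[R]_n -> 'cV[R]_n * 'cV[R]_n)
    (U : 'cV[R]_n * 'cV[R]_n) : 'cV[R]_n * 'cV[R]_n :=
  (etd1_comp L dt U.1 (N U).1, etd1_comp L dt U.2 (N U).2).

Definition etdrk2_step (R : realType) (n : nat) (L : 'M[R]_n) (dt : R)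
    (N : 'cV[R]_n * 'cV[R]_n -> 'cV[R]_n * 'cV[R]_n)
    (U : 'cV[R]_n * 'cV[R]_n) : 'cV[R]_n * 'cV[R]_n :=
  let V := etd1_step L dt N U in
  (V.1 + dt *: (fun_mx (@phi2 R) (dt *: L) *m ((N V).1 - (N U).1)),
   V.2 + dt *: (fun_mx (@phi2 R) (dt *: L) *m ((N V).2 - (N U).2))).

Definition entries01 (R : realType) (n : nat) (U : 'cV[R]_n * 'cV[R]_n) :=
  forall l : 'I_n, 0 <= U.1 l 0 <= 1 /\ 0 <= U.2 l 0 <= 1.

(* Main.v *)
(* Write L = s I - B with B entrywise nonnegative, so that exp(-tL) =
   exp(-ts) exp(tB) is entrywise nonnegative for t >= 0. Since
   phi1(a), phi2(a) and (phi1 - phi2)(a) are integrals over [0, 1] of exp(-ta)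
   against the nonnegative weights 1, 1 - t and t, the corresponding matrix
   functions are nonnegative too; and the constant vector is an eigenvector of L
   for the eigenvalue S. As S >= gamma makes the nonlinear term map [0, 1] into
   [0, S], each new iterate is bounded by phi0(S dt) + S dt phi1(S dt) = 1; for
   ETDRK2 one regroups the update as
   phi0 U + dt (phi1 - phi2) N(U) + dt phi2 N(V), V being the ETD1 predictor. *)

Require Import Defs.
From HB Require Import structures.
From mathcomp Require Import all_boot all_order all_algebra.
From mathcomp Require Import all_classical all_reals all_analysis.
From mathcomp Require Import ring lra.
From mathcomp.real_closed Require Import mxtens.

Import Order.TTheory GRing.Theory Num.Theory.
Import numFieldNormedType.Exports.

Local Open Scope ring_scope.

(** * Elementary inequalities from the sign of a derivative *)

Lemma ge0_of_derive (R : realType) (G g : R -> R) :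
  (forall t : R, is_derive t (1 : R) G (g t)) -> (forall t, 0 <= t -> 0 <= g t) ->
  G 0 = 0 -> forall t, 0 <= t -> 0 <= G t.
Proof.
move=> dG g0 G0 t t0; rewrite -G0.
apply: (@ger0_derive1_ndecr R G 0 t) => // [x|].
- rewrite in_itv /= => /andP[/ltW x0 _]; rewrite derive1E derive_val; exact: g0.
- by apply: derivable_within_continuous => x _; exact: ex_derive.
Qed.

Lemma sin_le_id (R : realType) (y : R) : 0 <= y -> sin y <= y.
Proof.
move=> y0; rewrite -subr_ge0; move: y y0.
apply: (@ge0_of_derive R (fun y => y - sin y) (fun y => 1 - cos y)).
- by move=> t _; rewrite subr_ge0 cos_le1.
- by rewrite sin0 subr0.
Qed.

Lemma oneB_cos_le_id (R : realType) (y : R) : 0 <= y -> 1 - cos y <= y.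
Proof.
move=> y0; rewrite -subr_ge0; move: y y0.
apply: (@ge0_of_derive R (fun y => y - (1 - cos y)) (fun y => 1 - sin y)).
- by move=> t; apply: is_derive_eq; ring.
- by move=> t _; rewrite subr_ge0 sin_le1.
- by rewrite cos0 subrr subr0.
Qed.

(** * Weighted sums of exponentials and of the phi functions *)

Lemma is_derive_sumM (R : realType) (n : nat) (c : 'I_n -> R) (F f : R -> 'I_n -> R)
    (t : R) : (forall k, is_derive t (1 : R) (F^~ k) (f t k)) ->
  is_derive t (1 : R) (fun t => \sum_k c k * F t k) (\sum_k c k * f t k).
Proof.
move=> dF.
rewrite (_ : (fun t => _) = \sum_k (c k \*: F^~ k)); last by rewrite fct_sumE.
by apply: is_derive_sum => k; exact: is_deriveZ.
Qed.

(* exp(-td) = exp(-ts) exp(t(s - d)), the last factor expanded as a power series. *)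
Lemma sum_expR_ge0 (R : realType) (n : nat) (c d : 'I_n -> R) (s t : R) :
  (forall m, 0 <= \sum_k c k * (s - d k) ^+ m) -> 0 <= t ->
  0 <= \sum_k c k * expR (- (t * d k)).
Proof.
move=> c0 t0.
have -> : \sum_k c k * expR (- (t * d k)) =
    expR (- (t * s)) * \sum_k c k * expR (t * (s - d k)).
  rewrite mulr_sumr; apply: eq_bigr => k _.
  by rewrite mulrCA -expRD; congr (_ * expR _); ring.
apply: mulr_ge0; first exact: expR_ge0.
have cv : (\sum_k c k * series (exp_coeff (t * (s - d k))) N @[N --> \oo] -->
    \sum_k c k * expR (t * (s - d k)))%classic.
  apply: cvg_big => [z|k _]; first by apply: cvgD; [exact: cvg_fst|exact: cvg_snd].
  by apply: cvgM; [exact: cvg_cst|exact: is_cvg_series_exp_coeff].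
apply: (cvgr_to_ge cv).
near=> N.
rewrite /series /=; under eq_bigr do rewrite mulr_sumr.
rewrite exchange_big sumr_ge0 // => m _.
rewrite (_ : \sum_(i < n) _ =
  t ^+ m / m`!%:R * \sum_k c k * (s - d k) ^+ m); last first.
  rewrite mulr_sumr; apply: eq_bigr => k _.
  by rewrite /exp_coeff /= exprMn; ring.
by rewrite mulr_ge0 // divr_ge0 // exprn_ge0.
Unshelve. all: by end_near.
Qed.

Section PhiSums.
Context {R : realType} {n : nat} (c d : 'I_n -> R) (s : R).
Hypothesis d0 : forall k, d k != 0.
Hypothesis c0 : forall m, 0 <= \sum_k c k * (s - d k) ^+ m.

(* Each of the next three sums vanishes at [t = 0] and has a nonnegative derivative. *)
Lemma sum_phi1_ge0 (t : R) : 0 <= t ->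
  0 <= \sum_k c k * ((1 - expR (- (t * d k))) / d k).
Proof.
move: t; apply: (@ge0_of_derive R _ (fun t => \sum_k c k * expR (- (t * d k)))).
- move=> t; apply: (@is_derive_sumM R n c
    (fun t k => ((1 - expR (- (t * d k))) / d k))
    (fun t k => expR (- (t * d k)))) => k.
  by apply: is_derive_eq; rewrite /GRing.scale /=; field.
- by move=> t t0; exact: (sum_expR_ge0 _ _ _ _ s).
- by rewrite big1 // => k _; rewrite mul0r oppr0 expR0 subrr mul0r mulr0.
Qed.

Lemma sum_phi2_ge0 (t : R) : 0 <= t ->
  0 <= \sum_k c k * ((expR (- (t * d k)) - 1 + t * d k) / d k ^+ 2).
Proof.
(* For [t != 0] the weighted term is [t ^+ 2 * phi2 (t * d k)]; the factor [t ^+ 2] makes its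
   derivative the term of [sum_phi1_ge0]. *)
move: t; apply: (@ge0_of_derive R _ _ _ sum_phi1_ge0).
- move=> t; apply: (@is_derive_sumM R n c
    (fun t k => ((expR (- (t * d k)) - 1 + t * d k) / d k ^+ 2))
    (fun t k => ((1 - expR (- (t * d k))) / d k))) => k.
  by apply: is_derive_eq; rewrite /GRing.scale /=; field.
- by rewrite big1 // => k _; rewrite mul0r oppr0 expR0 subrr addr0 mul0r mulr0.
Qed.

Lemma sum_phi1B2_ge0 (t : R) : 0 <= t ->
  0 <= \sum_k c k * ((1 - expR (- (t * d k)) * (1 + t * d k)) / d k ^+ 2).
Proof.
(* Here the term is [t ^+ 2 * (phi1 - phi2) (t * d k)], with derivative [t * expR (- (t * d k))]. *)
move: t; apply: (@ge0_of_derive R _ (fun t => \sum_k c k * (t * expR (- (t * d k))))).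
- move=> t; apply: (@is_derive_sumM R n c
    (fun t k => ((1 - expR (- (t * d k)) * (1 + t * d k)) / d k ^+ 2))
    (fun t k => (t * expR (- (t * d k))))) => k.
  by apply: is_derive_eq; rewrite /GRing.scale /=; field.
- move=> t t0; under eq_bigr do rewrite mulrCA.
  by rewrite -mulr_sumr mulr_ge0 // (sum_expR_ge0 _ _ _ _ s).
- rewrite big1 // => k _.
  by rewrite mul0r oppr0 expR0 addr0 mulr1 subrr mul0r mulr0.
Qed.

End PhiSums.

(** * Bounds on the nonlinear term *)

(** With [x = pi * u / eps1] the middle branch is [(pi + x + sin x) / (2 * pi)], and both bounds are
    [sin y <= y] at [y = pi + x] and [y = pi - x]. *)
Lemma heaviside_reg01 (R : realType) (eps1 u : R) : 0 < eps1 ->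
  0 <= heaviside_reg eps1 u <= 1.
Proof.
move=> e0; rewrite /heaviside_reg; case: ifPn => [|_]; last first.
  by case: ifP; rewrite ?lexx ler01.
rewrite ler_norml => /andP[lu ul].
have p0 := pi_gt0 R.
set x := pi * u / eps1.
have -> : 1 / (2 * eps1) * (u + eps1 / pi * sin x) + 1 / 2 =
    (2 * pi)^-1 * (pi + x + sin x).
  rewrite [in pi + x]/x; move: (sin x) (pi : R) p0 => y q q0.
  by field; rewrite !gt_eqF.
have xl : - pi <= x by rewrite /x ler_pdivlMr // mulNr -mulrN ler_pM2l.
have xu : x <= pi by rewrite /x ler_pdivrMr // ler_pM2l.
have h1 : sin (x + pi) <= x + pi by apply: sin_le_id; lra.
have h2 : sin (- x + pi) <= - x + pi by apply: sin_le_id; lra.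
rewrite !sinDpi sinN in h1 h2.
apply/andP; split; first by rewrite mulr_ge0 ?invr_ge0; lra.
rewrite -[leRHS](@mulVf _ (2 * pi)) ?gt_eqF ?mulr_gt0 //.
by rewrite ler_pM2l ?invr_gt0 ?mulr_gt0 //; lra.
Qed.

Lemma delta_reg_ge0 (R : realType) (eps1 u : R) : 0 < eps1 -> 0 <= delta_reg eps1 u.
Proof.
move=> e0; rewrite /delta_reg; case: ifP => // _.
rewrite mulr_ge0 ?divr_ge0 ?mulr_ge0 ?(ltW e0) //.
Qed.

Lemma delta_regN (R : realType) (eps1 u : R) :
  delta_reg eps1 (- u) = delta_reg eps1 u.
Proof. by rewrite /delta_reg normrN mulrN mulNr cosN. Qed.

(** Lets [S * u] absorb the fitting term near [u = 0]. From [1 + cos x = 1 - cos (x + pi) <= x + pi]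
    comes a line vanishing at [u = 1 / 2 - eps1]; as [eps1 < 1 / 2], it lies below the parallel line
    through the origin. *)
Lemma delta_reg_le (R : realType) (eps1 u : R) : 0 < eps1 < 1 / 2 -> 0 <= u ->
  delta_reg eps1 (u - 1 / 2) <= pi / (2 * eps1 ^+ 2) * u.
Proof.
move=> /andP[e0 e1] u0; have p0 := pi_gt0 R.
rewrite /delta_reg; case: ifPn => [|_]; last first.
  by rewrite !mulr_ge0 ?invr_ge0 ?mulr_ge0 ?exprn_ge0 ?(ltW e0) ?(ltW p0).
rewrite ler_norml => /andP[lu ul].
set x := pi * (u - 1 / 2) / eps1.
have xl : - pi <= x by rewrite /x ler_pdivlMr // mulNr -mulrN ler_pM2l.
have h : 1 - cos (x + pi) <= x + pi by apply: oneB_cos_le_id; lra.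
rewrite cosDpi opprK in h.
apply: (@le_trans _ _ (1 / (2 * eps1) * (x + pi))).
  by rewrite ler_pM2l ?divr_gt0 ?mulr_gt0.
have -> : 1 / (2 * eps1) * (x + pi) = pi / (2 * eps1 ^+ 2) * (u - 1 / 2 + eps1).
  by rewrite /x; field; rewrite ?(gt_eqF p0) gt_eqF.
rewrite ler_pM2l; first by lra.
by rewrite divr_gt0 ?mulr_gt0 ?exprn_gt0.
Qed.

(** Each summand is a convex combination, with weights [H] and [1 - H], of two differences of
    numbers in [0, 1], so its modulus is at most 1. *)
Lemma norm_fit_sum_le (R : realType) (n : nat) (v a b c d : 'I_n -> R) (H : R) :
  (forall r, 0 <= v r <= 1) -> (forall r, 0 <= a r <= 1) ->
  (forall r, 0 <= b r <= 1) -> (forall r, 0 <= c r <= 1) ->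
  (forall r, 0 <= d r <= 1) -> 0 <= H <= 1 ->
  `|\sum_(r < n) (((v r - a r) ^+ 2 - (v r - b r) ^+ 2) * H
     + ((v r - c r) ^+ 2 - (v r - d r) ^+ 2) * (1 - H))| <= n%:R.
Proof.
move=> v01 a01 b01 c01 d01 /andP[H0 H1].
have sq01 (x y : R) : 0 <= x <= 1 -> 0 <= y <= 1 -> 0 <= (x - y) ^+ 2 <= 1.
  move=> /andP[x0 x1] /andP[y0 y1]; rewrite sqr_ge0 -real_normK ?num_real // expr_le1 //.
  by rewrite ler_norml; lra.
rewrite (le_trans (ler_norm_sum _ _ _)) //.
rewrite -[X in _ <= X%:R](card_ord n) -sumr_const ler_sum // => r _.
have /andP[? ?] := sq01 _ _ (v01 r) (a01 r).
have /andP[? ?] := sq01 _ _ (v01 r) (b01 r).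
have /andP[? ?] := sq01 _ _ (v01 r) (c01 r).
have /andP[? ?] := sq01 _ _ (v01 r) (d01 r).
by rewrite ler_norml; apply/andP; split; nra.
Qed.

(** Both subtracted terms are at most a multiple of [u]: the well term because
    [(2 * u - 1) * (u - 1) <= 1] on [0, 1], the fitting term by [delta_reg_le]. The two slopes add
    up to at most [S]. *)
Lemma reaction_ge0 (R : realType) (eps eps1 S F K u : R) :
  0 < eps -> 0 < eps1 < 1 / 2 -> `|F| <= K ->
  2 / eps + K * pi / (2 * eps1 ^+ 2) <= S -> 0 <= u <= 1 ->
  0 <= S * u - 1 / eps * dwell u - F * delta_reg eps1 (u - 1 / 2).
Proof.
move=> e0 he1 FK hS /andP[u0 u1]; have /andP[e10 _] := he1.
have hw : 1 / eps * dwell u <= 2 / eps * u.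
  rewrite (_ : 2 / eps * u = 1 / eps * (2 * u)); last by field; rewrite gt_eqF.
  by rewrite ler_pM2l ?divr_gt0 // /dwell; nra.
have hF : F * delta_reg eps1 (u - 1 / 2) <= K * (pi / (2 * eps1 ^+ 2) * u).
  apply: (le_trans (ler_norm _)); rewrite normrM [X in _ * X]ger0_norm ?delta_reg_ge0 //.
  by rewrite ler_pM ?delta_reg_ge0 ?delta_reg_le.
have := ler_wpM2r u0 hS; rewrite mulrDl -[K * pi / _]mulrA -[K * _ * u]mulrA.
lra.
Qed.

(* The upper bound is the lower one at [1 - u], [F] changing sign. *)
Lemma reaction_bounds (R : realType) (eps eps1 S F K u : R) :
  0 < eps -> 0 < eps1 < 1 / 2 -> `|F| <= K ->
  2 / eps + K * pi / (2 * eps1 ^+ 2) <= S -> 0 <= u <= 1 ->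
  0 <= S * u - 1 / eps * dwell u - F * delta_reg eps1 (u - 1 / 2) <= S.
Proof.
move=> e0 he1 FK hS u01; apply/andP; split.
  exact: (@reaction_ge0 _ _ _ _ _ K).
have u01' : 0 <= 1 - u <= 1 by lra.
have := @reaction_ge0 _ _ _ _ (- F) K _ e0 he1 _ hS u01'; rewrite normrN => /(_ FK).
rewrite (_ : 1 - u - 1 / 2 = - (u - 1 / 2)); last by field.
rewrite delta_regN (_ : dwell (1 - u) = - dwell u); last by rewrite /dwell; ring.
lra.
Qed.

Lemma nonlin_bounds (R : realType) (n omega : nat) (eps lambda eps1 S : R)
    (img : 'I_n -> 'I_omega -> R) (C : intensities R omega)
    (U : 'cV[R]_n * 'cV[R]_n) :
  0 < eps -> 0 < lambda -> 0 < eps1 < 1 / 2 ->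
  (forall l r, 0 <= img l r <= 1) ->
  (forall r, [/\ 0 <= C11 C r <= 1, 0 <= C12 C r <= 1,
                 0 <= C21 C r <= 1 & 0 <= C22 C r <= 1]) ->
  2 / eps + 2 * omega%:R * lambda * pi / eps1 ^+ 2 <= S ->
  entries01 U ->
  forall l, (0 <= (nonlin eps lambda eps1 S img C U).1 l 0 <= S) /\
            (0 <= (nonlin eps lambda eps1 S img C U).2 l 0 <= S).
Proof.
move=> e0 l0 he1 himg hC hS U01 l; have /andP[e10 _] := he1.
have [u1 u2] := U01 l.
(* The reaction bounds are used with [K = lambda * omega%:R]; the fitting part of gamma is four
   times the resulting slope. *)
have hS' : 2 / eps + (lambda * omega%:R) * pi / (2 * eps1 ^+ 2) <= S.
  apply: le_trans hS; rewrite lerD2l.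
  rewrite (_ : 2 * omega%:R * lambda * pi / eps1 ^+ 2 =
    4 * (lambda * omega%:R * pi / (2 * eps1 ^+ 2))); last by field; rewrite gt_eqF.
  apply: ler_peMl; last by lra.
  by rewrite !mulr_ge0 ?invr_ge0 ?mulr_ge0 ?exprn_ge0 ?(ltW l0) ?(ltW e10) ?pi_ge0.
have hfit x : `|x| <= omega%:R -> `|lambda * x| <= lambda * omega%:R.
  by move=> hx; rewrite normrM gtr0_norm // ler_pM2l.
rewrite !mxE; split; apply: reaction_bounds hS' _ => //;
  apply: hfit; apply: norm_fit_sum_le => // [r|r|r|r|].
all: try exact: heaviside_reg01.
all: by case: (hC r).
Qed.

(** * Sign and row sums of functions of a diagonalized matrix *)

Section SpectralCalculus.
Context {R : realType} {n : nat} (P : 'M[R]_n) (d : 'rV[R]_n).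
Hypothesis Pu : P \in unitmx.

Let F (f : R -> R) := invmx P *m diag_mx (map_mx f d) *m P.

(** Reduces entrywise signs to the scalar sums above, with weights [invmx P i k * P k j] that do not
    depend on [f]. *)
Lemma spec_mxE (f : R -> R) (i j : 'I_n) :
  F f i j = \sum_k invmx P i k * P k j * f (d 0 k).
Proof.
rewrite /F mul_mx_diag mxE; apply: eq_bigr => k _.
by rewrite !mxE mulrAC.
Qed.

Lemma spec_mxM (f g : R -> R) : F f *m F g = F (fun x => f x * g x).
Proof.
rewrite /F !mulmxA mulmxK // -[_ *m diag_mx _ *m diag_mx _]mulmxA mulmx_diag.
by congr (_ *m diag_mx _ *m _); apply/rowP => k; rewrite !mxE.
Qed.

Lemma spec_mx_cst (c : R) : F (fun=> c) = c%:M.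
Proof.
rewrite /F (_ : map_mx _ d = const_mx c); last by apply/rowP => k; rewrite !mxE.
by rewrite diag_const_mx mul_mx_scalar -scalemxAl mulVmx // scalemx1.
Qed.

Context (a : R).
Hypothesis A_offdiag : forall i j, i != j -> F id i j <= 0.
Hypothesis A_rowsum : F id *m (const_mx 1 : 'cV_n) = const_mx a.

(** In the eigenbasis the ones vector becomes [w], and [d 0 k = a] wherever [w k 0] is nonzero; so
    [f (d 0 k)] may be replaced by [f a] on [w]. *)
Lemma spec_mx_rowsum (f : R -> R) : F f *m (const_mx 1 : 'cV_n) = const_mx (f a).
Proof.
set w := P *m (const_mx 1 : 'cV_n).
have wk k : d 0 k * w k 0 = a * w k 0.
  have := congr1 (fun X => (P *m X) k 0) A_rowsum.
  rewrite /F !mulmxA mulmxV // mul1mx -mulmxA -/w mul_diag_mx.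
  rewrite (_ : const_mx a = a *: const_mx 1); last first.
    by apply/colP => l; rewrite !mxE mulr1.
  by rewrite -scalemxAr -/w !mxE.
have -> : const_mx (f a) = invmx P *m (f a *: w).
  rewrite -scalemxAr /w mulmxA mulVmx // mul1mx.
  by apply/colP => l; rewrite !mxE mulr1.
rewrite /F -!mulmxA -/w; congr (_ *m _); apply/colP => k.
rewrite mul_diag_mx [LHS]mxE [X in X * _]mxE [RHS]mxE.
have [->|wk0] := eqVneq (w k 0) 0; first by rewrite !mulr0.
by rewrite (mulIf wk0 (wk k)).
Qed.

(* Gershgorin's argument at an entry of maximal modulus of an eigenvector. *)
Lemma spec_mx_eig_ge (k : 'I_n) : a <= d 0 k.
Proof.
(* The columns of [invmx P] are eigenvectors. *)
pose v : 'cV_n := invmx P *m delta_mx k 0.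
have Pv : P *m v = delta_mx k 0 by rewrite mulmxA mulmxV // mul1mx.
have Av : F id *m v = d 0 k *: v.
  rewrite /F -mulmxA Pv -mulmxA scalemxAr; congr (_ *m _); apply/colP => i.
  rewrite mul_diag_mx !mxE eqxx andbT.
  by have [->|_] := eqVneq i k; rewrite ?mulr0.
have [i vi] : exists i, v i 0 != 0.
  apply/existsP; rewrite -negb_forall; apply/negP => /forallP v0.
  have : (P *m v) k 0 = 0.
    by rewrite mxE big1 // => i _; rewrite (eqP (v0 i)) mulr0.
  by rewrite Pv mxE !eqxx => /eqP; rewrite oner_eq0.
have [i0 _ imax] := @Order.TotalTheory.arg_maxP _ _ _ i xpredT (fun i => `|v i 0|) isT.
have vi0 : 0 < `|v i0 0| by apply: lt_le_trans (imax i isT); rewrite normr_gt0.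
have sumv : \sum_j F id i0 j * v j 0 = d 0 k * v i0 0.
  by transitivity ((F id *m v) i0 0); [rewrite mxE | rewrite Av mxE].
have sum1 : \sum_j F id i0 j = a.
  transitivity ((F id *m (const_mx 1 : 'cV_n)) i0 0).
    by rewrite mxE; apply: eq_bigr => j _; rewrite [const_mx _ _ _]mxE mulr1.
  by rewrite A_rowsum mxE.
have vv : 0 < v i0 0 ^+ 2 by rewrite -real_normK ?num_real // exprn_gt0.
(* Multiplying [d 0 k - a] by the square of the maximal entry gives a sum whose off-diagonal terms
   are products of two nonpositive factors and whose diagonal term is 0. *)
rewrite -subr_ge0 -(pmulr_lge0 _ vv).
rewrite (_ : _ * _ = \sum_j F id i0 j * (v j 0 * v i0 0 - v i0 0 ^+ 2)); last first.
  rewrite mulrBl [in LHS]expr2 mulrA -sumv -sum1 !mulr_suml -sumrB.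
  by apply: eq_bigr => j _; ring.
apply: sumr_ge0 => j _; have [<-|ij] := eqVneq i0 j.
  by rewrite -expr2 subrr mulr0.
rewrite mulr_le0 ?A_offdiag // subr_le0.
apply: (le_trans (ler_norm _)); rewrite normrM -[leRHS]real_normK ?num_real //.
by rewrite expr2 ler_wpM2r //; exact: imax.
Qed.

(** The sum is an entry of the m-th power of [s%:M - F id], which is entrywise nonnegative once [s]
    dominates the diagonal. This is the hypothesis [c0] of the scalar sums. *)
Lemma spec_mx_pow_ge0 : exists s, forall i j m,
  0 <= \sum_k invmx P i k * P k j * (s - d 0 k) ^+ m.
Proof.
exists (\sum_i `|F id i i|) => i j m; set s := \sum_i `|_|.
suff : 0 <= F (fun x => (s - x) ^+ m) i j by rewrite spec_mxE.
elim: m i j => [|m IHm] i j.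
  by rewrite (_ : F _ = 1%:M) ?spec_mx_cst // mxE; case: eqP.
rewrite (_ : F _ = F (fun x => (s - x) ^+ m) *m F (fun x => s - x)); last first.
  rewrite spec_mxM; congr (_ *m diag_mx _ *m _).
  by apply/rowP => l; rewrite !mxE exprSr.
rewrite mxE sumr_ge0 // => l _; rewrite mulr_ge0 {IHm}//.
have -> : F (fun x => s - x) l j = s%:M l j - F id l j.
  rewrite -spec_mx_cst !spec_mxE -sumrB.
  by apply: eq_bigr => k _; rewrite mulrBr.
rewrite mxE; have [<-|lj] := eqVneq l j; last first.
  by rewrite mulr0n sub0r oppr_ge0 A_offdiag.
rewrite mulr1n subr_ge0 (le_trans (ler_norm _)) // /s (bigD1 l) //= lerDl.
exact: sumr_ge0.
Qed.

Hypothesis a0 : 0 < a.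

(** Keeps the spectrum away from the junk values of [phi1] and [phi2] at 0. *)
Let d_neq0 k : d 0 k != 0.
Proof. by rewrite gt_eqF // (lt_le_trans a0) // spec_mx_eig_ge. Qed.

Lemma spec_mx_phi0_ge0 (i j : 'I_n) : 0 <= F (@phi0 R) i j.
Proof.
have [s hs] := spec_mx_pow_ge0.
rewrite spec_mxE; have := sum_expR_ge0 _ _ _ _ _ 1 (hs i j) ler01.
by under eq_bigr do rewrite mul1r.
Qed.

Lemma spec_mx_phi1_ge0 (i j : 'I_n) : 0 <= F (@phi1 R) i j.
Proof.
have [s hs] := spec_mx_pow_ge0.
rewrite spec_mxE; have := sum_phi1_ge0 _ _ _ d_neq0 (hs i j) 1 ler01.
by under eq_bigr do rewrite mul1r.
Qed.

Lemma spec_mx_phi2_ge0 (i j : 'I_n) : 0 <= F (@phi2 R) i j.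
Proof.
have [s hs] := spec_mx_pow_ge0.
rewrite spec_mxE; have := sum_phi2_ge0 _ _ _ d_neq0 (hs i j) 1 ler01.
by under eq_bigr do rewrite mul1r.
Qed.

Lemma spec_mx_phi2_le1 (i j : 'I_n) : F (@phi2 R) i j <= F (@phi1 R) i j.
Proof.
have [s hs] := spec_mx_pow_ge0.
rewrite -subr_ge0 !spec_mxE -sumrB.
(* At [t = 1] the term is [phi1 - phi2], equal to [(1 - expR (- x) * (1 + x)) / x ^+ 2] at
   [x = d 0 k]. *)
have := sum_phi1B2_ge0 _ _ _ d_neq0 (hs i j) 1 ler01.
congr (0 <= _); apply: eq_bigr => k _; rewrite mul1r /phi1 /phi2.
by field; exact: d_neq0.
Qed.

End SpectralCalculus.

(** * Bounds on a single time step *)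

(** A nonnegative matrix is monotone, so [u] can be compared with the constant vectors 0 and [c]. *)
Lemma mulmx_col_bounds (R : realType) (n : nat) (E : 'M[R]_n) (u : 'cV[R]_n) (c e : R) :
  (forall i j, 0 <= E i j) -> E *m (const_mx 1 : 'cV_n) = const_mx e ->
  (forall l, 0 <= u l 0 <= c) -> forall i, 0 <= (E *m u) i 0 <= c * e.
Proof.
move=> E0 E1 u0c i; rewrite mxE; apply/andP; split.
  by apply: sumr_ge0 => j _; rewrite mulr_ge0 //; case/andP: (u0c j).
have := congr1 (fun X : 'cV_n => X i 0) E1; rewrite !mxE => <-.
rewrite mulr_sumr; apply: ler_sum => j _; rewrite mxE mulr1 mulrC ler_wpM2r //.
by case/andP: (u0c j).
Qed.

Section EtdBounds.
Context {R : realType} {n : nat} (L : 'M[R]_n) (dt S : R).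
Hypotheses (dt0 : 0 < dt) (S0 : 0 < S) (Lsym : L^T = L).
Hypothesis L_offdiag : forall i j, i != j -> L i j <= 0.
Hypothesis L_rowsum : L *m (const_mx 1 : 'cV_n) = const_mx S.

Let E f := fun_mx f (dt *: L).

Let EP : [/\ forall i j, 0 <= E (@phi0 R) i j, forall i j, 0 <= E (@phi2 R) i j,
   forall i j, E (@phi2 R) i j <= E (@phi1 R) i j
 & forall f, E f *m (const_mx 1 : 'cV_n) = const_mx (f (dt * S))].
Proof.
have symA : (dt *: L)^T = dt *: L by rewrite linearZ /= Lsym.
(* One diagonalization, obtained for [id], serves every [f] through [fun_mxP]. *)
have [_ [P [d [Pu AE _]]]] := sym_is_fun_mx id symA.
have Ef f : E f = invmx P *m diag_mx (map_mx f d) *m P.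
  by apply/fun_mxP => //; exists P, d.
have {}AE : dt *: L = invmx P *m diag_mx (map_mx id d) *m P.
  by rewrite AE; congr (_ *m diag_mx _ *m _); apply/rowP => k; rewrite mxE.
have offd i j : i != j -> (invmx P *m diag_mx (map_mx id d) *m P) i j <= 0.
  by move=> ij; rewrite -AE mxE mulr_ge0_le0 ?L_offdiag // ltW.
have rows : invmx P *m diag_mx (map_mx id d) *m P *m (const_mx 1 : 'cV_n) =
    const_mx (dt * S).
  by rewrite -AE -scalemxAl L_rowsum; apply/colP => l; rewrite !mxE.
have a0 := mulr_gt0 dt0 S0.
split=> [i j|i j|i j|f]; rewrite !Ef.
- exact: spec_mx_phi0_ge0.
- exact: spec_mx_phi2_ge0 rows a0 _ _.
- exact: spec_mx_phi2_le1 rows a0 _ _.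
- exact: spec_mx_rowsum.
Qed.

Lemma etd1_comp_bounds (u Nu : 'cV[R]_n) :
  (forall l, 0 <= u l 0 <= 1) -> (forall l, 0 <= Nu l 0 <= S) ->
  forall l, 0 <= etd1_comp L dt u Nu l 0 <= 1.
Proof.
move=> u01 N0S l; have [E0 E2 E12 E1] := EP.
have E1_ge0 i j : 0 <= E (@phi1 R) i j by apply: le_trans (E12 i j).
have /andP[h1 h2] := mulmx_col_bounds _ _ _ _ _ _ E0 (E1 _) u01 l.
have /andP[h3 h4] := mulmx_col_bounds _ _ _ _ _ _ E1_ge0 (E1 _) N0S l.
rewrite /etd1_comp !mxE -!/(E _); rewrite !mxE in h1 h2 h3 h4.
rewrite addr_ge0 //=; last by rewrite mulr_ge0 // ltW.
apply: (le_trans (lerD h2 (ler_wpM2l (ltW dt0) h4))).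
(* The upper bound equals 1 exactly, whatever [dt * S] is. *)
rewrite /phi0 /phi1 le_eqVlt; apply/orP; left; apply/eqP.
by field; rewrite !gt_eqF.
Qed.

Lemma etdrk2_comp_bounds (u Nu Nv : 'cV[R]_n) :
  (forall l, 0 <= u l 0 <= 1) -> (forall l, 0 <= Nu l 0 <= S) ->
  (forall l, 0 <= Nv l 0 <= S) ->
  forall l, 0 <= (etd1_comp L dt u Nu + dt *: (E (@phi2 R) *m (Nv - Nu))) l 0 <= 1.
Proof.
move=> u01 Nu0S Nv0S l; have [E0 E2 E12 E1] := EP.
(* The sign of [Nv - Nu] is unknown; collecting the coefficients of [Nu] and [Nv] separately leaves
   only nonnegative matrices. *)
pose E12m := E (@phi1 R) - E (@phi2 R).
have E12m_ge0 i j : 0 <= E12m i j by rewrite !mxE subr_ge0.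
have E12m1 : E12m *m (const_mx 1 : 'cV_n) =
    const_mx (phi1 (dt * S) - phi2 (dt * S)).
  by rewrite mulmxBl !E1; apply/colP => k; rewrite !mxE.
have /andP[h1 h2] := mulmx_col_bounds _ _ _ _ _ _ E0 (E1 _) u01 l.
have /andP[h3 h4] := mulmx_col_bounds _ _ _ _ _ _ E12m_ge0 E12m1 Nu0S l.
have /andP[h5 h6] := mulmx_col_bounds _ _ _ _ _ _ E2 (E1 _) Nv0S l.
have -> : etd1_comp L dt u Nu + dt *: (E (@phi2 R) *m (Nv - Nu)) =
    E (@phi0 R) *m u + dt *: (E12m *m Nu + E (@phi2 R) *m Nv).
  rewrite /etd1_comp /E12m -!/(E _) mulmxBl mulmxBr -addrA -scalerDr.
  by congr (_ + _ *: _); rewrite addrAC -addrA addrC; congr (_ + _); rewrite addrC.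
rewrite mxE [X in _ + X]mxE [X in dt * X]mxE.
rewrite addr_ge0 //=; last by rewrite mulr_ge0 ?addr_ge0 // ltW.
apply: (le_trans (lerD h2 (ler_wpM2l (ltW dt0) (lerD h4 h6)))).
rewrite /phi0 /phi1 /phi2 le_eqVlt; apply/orP; left; apply/eqP.
by field; rewrite !gt_eqF.
Qed.

End EtdBounds.

(** * Signs and row sums of the discrete Laplacian *)

Lemma neumann_lap_offdiag_ge0 (R : realType) (M : nat) (i j : 'I_M) :
  i != j -> 0 <= neumann_lap R M i j.
Proof. by move=> /negPf ij; rewrite mxE ij. Qed.

Lemma sum_ord_eq (R : realType) (M k : nat) :
  \sum_(j < M) (k == j :> nat)%:R = (k < M)%:R :> R.
Proof.
case: ltnP => [kM|Mk].
  rewrite (bigD1 (Ordinal kM)) //= eqxx big1 ?addr0 // => j jk.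
  by rewrite (_ : (k == j) = false) //; apply/eqP => kj; case/eqP: jk; apply/val_inj.
by rewrite big1 // => j _; rewrite gtn_eqF // (leq_trans (ltn_ord j)).
Qed.

Lemma neumann_lap_rowsum (R : realType) (M : nat) :
  neumann_lap R M *m (const_mx 1 : 'cV_M) = 0.
Proof.
apply/colP => i; rewrite !mxE.
under eq_bigr do rewrite !mxE mulr1.
rewrite (bigD1 i) //= eqxx.
rewrite (eq_bigr (fun j : 'I_M => (i.+1 == j :> nat)%:R + (j.+1 == i :> nat)%:R));
  last first.
  move=> j ji; rewrite eq_sym (negPf ji); have [<-|_] := eqVneq i.+1 j.
    by rewrite gtn_eqF // addr0.
  by rewrite add0r.
(* The index [i] can be put back: it is neither its own successor nor its own predecessor, so it
   contributes 0. *)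
have -> : \sum_(j < M | j != i) ((i.+1 == j :> nat)%:R + (j.+1 == i :> nat)%:R) =
  \sum_(j < M) ((i.+1 == j :> nat)%:R + (j.+1 == i :> nat)%:R) :> R.
  by rewrite [RHS](bigD1 i) //= gtn_eqF // !add0r.
rewrite big_split /= sum_ord_eq.
have -> : \sum_(j < M) (j.+1 == i :> nat)%:R = (0 < i)%:R :> R.
  case: i => -[|k] km /=; first by rewrite big1.
  under eq_bigr do rewrite eqSS eq_sym.
  by rewrite sum_ord_eq (ltnW km).
by rewrite natrD [X in - X]addrC addNr.
Qed.

(** The ones vector is the tensor product of two ones vectors. *)
Lemma tensmx_mul_const1 (R : realType) (m n : nat) (A : 'M[R]_m) (B : 'M[R]_n) :
  tensmx A B *m (const_mx 1 : 'cV_(m * n)) =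
  tensmx (A *m (const_mx 1 : 'cV_m)) (B *m (const_mx 1 : 'cV_n)).
Proof.
rewrite -tensmx_mul; congr (_ *m _).
by apply/matrixP => i j; rewrite !mxE mulr1.
Qed.

Lemma Dh_rowsum (R : realType) (M1 M2 : nat) (h : R) :
  Dh M1 M2 h *m (const_mx 1 : 'cV_(M2 * M1)) = 0.
Proof.
rewrite /Dh -scalemxAl mulmxDl !tensmx_mul_const1 !neumann_lap_rowsum.
by rewrite tensmx0 tens0mx addr0 scaler0.
Qed.

Lemma Dh_offdiag_ge0 (R : realType) (M1 M2 : nat) (h : R) (i j : 'I_(M2 * M1)) :
  i != j -> 0 <= Dh M1 M2 h i j.
Proof.
case: (mxtens_indexP i) => i2 i1; case: (mxtens_indexP j) => j2 j1 ij.
rewrite mxE [X in _ * X]mxE mulr_ge0 ?invr_ge0 ?sqr_ge0 //.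
rewrite !tensmxE ![1%:M _ _]mxE.
(* Pixels differing in one coordinate meet one Kronecker term; if both coordinates differ, both
   identity factors vanish. *)
have [e2|n2] := eqVneq i2 j2; have [e1|n1] := eqVneq i1 j1.
- by rewrite e1 e2 eqxx in ij.
- by rewrite mulr0 addr0 mul1r neumann_lap_offdiag_ge0.
- by rewrite mul0r add0r mulr1 neumann_lap_offdiag_ge0.
- by rewrite mul0r mulr0 addr0.
Qed.

Lemma Lh_rowsum (R : realType) (M1 M2 : nat) (h eps S : R) :
  Lh M1 M2 h eps S *m (const_mx 1 : 'cV_(M2 * M1)) = const_mx S.
Proof.
rewrite /Lh mulmxDl -scalemxAl Dh_rowsum scaler0 add0r mul_scalar_mx.
by apply/colP => l; rewrite !mxE mulr1.
Qed.

Lemma Lh_offdiag_le0 (R : realType) (M1 M2 : nat) (h eps S : R)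
    (i j : 'I_(M2 * M1)) : 0 < eps -> i != j -> Lh M1 M2 h eps S i j <= 0.
Proof.
move=> e0 ij; rewrite /Lh mxE [X in X + _]mxE [X in _ + X]mxE (negPf ij) addr0.
by rewrite mulNr oppr_le0 !mulr_ge0 ?Dh_offdiag_ge0 // ltW.
Qed.

Theorem theorem3p2 (R : realType) (M1 M2 omega : nat)
    (eps lambda h dt eps1 S : R)
    (img : 'I_(M2 * M1) -> 'I_omega -> R) (C : intensities R omega)
    (u0 : 'cV[R]_(M2 * M1) * 'cV[R]_(M2 * M1))
    (U : nat -> 'cV[R]_(M2 * M1) * 'cV[R]_(M2 * M1))
    (heps : 0 < eps) (hlambda : 0 < lambda) (hh : 0 < h) (hdt : 0 < dt)
    (heps1 : 0 < eps1 < 1 / 2)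
    (himg : forall l r, 0 <= img l r <= 1)
    (hC : forall r, [/\ 0 <= C11 C r <= 1, 0 <= C12 C r <= 1,
                        0 <= C21 C r <= 1 & 0 <= C22 C r <= 1])
    (hS0 : 0 < S)
    (hS : let gamma := 2 / eps + 2 * omega%:R * lambda * pi / eps1 ^+ 2 in
          gamma <= S)
    (hU0 : U 0%N = u0)
    (hU : let L := Lh M1 M2 h eps S in
          let N := nonlin eps lambda eps1 S img C in
          (forall k, U k.+1 = etd1_step L dt N (U k))
          \/ (forall k, U k.+1 = etdrk2_step L dt N (U k)))
    (hu0 : entries01 u0) :
  forall k, (0 < k)%N -> entries01 (U k).
Proof.
have NS V : entries01 V -> forall l,
    0 <= (nonlin eps lambda eps1 S img C V).1 l 0 <= S /\
    0 <= (nonlin eps lambda eps1 S img C V).2 l 0 <= S.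
  exact: nonlin_bounds.
have etd1_01 V : entries01 V ->
    entries01 (etd1_step (Lh M1 M2 h eps S) dt (nonlin eps lambda eps1 S img C) V).
  move=> V01 l; split; apply: etd1_comp_bounds hdt hS0 (Lh_sym _ _ _ _ _) _
      (Lh_rowsum _ _ _ _ _ _) _ _ _ _ _ => [i j|k|k].
  - exact: Lh_offdiag_le0.
  - by case: (V01 k).
  - by case: (NS V V01 k).
  - exact: Lh_offdiag_le0.
  - by case: (V01 k).
  - by case: (NS V V01 k).
move=> k _; elim: k => [|k IHk]; first by rewrite hU0.
case: hU => ->; first exact: etd1_01.
(* The predictor is itself an ETD1 step, hence in [0, 1], so the nonlinear term at it is bounded as
   well. *)
have V01 := etd1_01 _ IHk.
move=> l; split; apply: etdrk2_comp_bounds hdt hS0 (Lh_sym _ _ _ _ _) _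
    (Lh_rowsum _ _ _ _ _ _) _ _ _ _ _ _ _ => [i j|m|m|m].
- exact: Lh_offdiag_le0.
- by case: (IHk m).
- by case: (NS _ IHk m).
- by case: (NS _ V01 m).
- exact: Lh_offdiag_le0.
- by case: (IHk m).
- by case: (NS _ IHk m).
- by case: (NS _ V01 m).
Qed.
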